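(* Let $(\mathbb G^\omega,(\|\cdot\|_n)_{n<\omega})$ and $(\mathbb G^\omega,(\|\cdot\|'_n)_{n<\omega})$ be, respectively, the graded and the non-graded Gurarij-type Fréchet spaces of Bargetz, Kąkol and Kubiś described in the context. Then $(\mathbb G^\omega,(\|\cdot\|_n)_{n<\omega})$ is approximately $\mathcal G_{<\omega}$-ultrahomogeneous and $(\mathbb G^\omega,(\|\cdot\|'_n)_{n<\omega})$ is approximately $\mathcal M_{<\omega}$-ultrahomogeneous. In particular, up to multi-isometry, $(\mathbb G^\omega,(\|\cdot\|_n)_{n<\omega})=\mathrm{Flim}(\mathcal G_{<\omega})$ and $(\mathbb G^\omega,(\|\cdot\|'_n)_{n<\omega})=\mathrm{Flim}(\mathcal M_{<\omega})$.
   Context: Conventions: $\omega=\{0,1,2,\dots\}$, $\mathbb N=\{1,2,\dots\}$; vector spaces are real; classes of spaces are considered up to multi-isometry. A multi-seminormed space is a vector space $X$ with a sequence of seminorms $(\|\cdot\|_{X,n})_{n<\lambda_X}$, where $1\le\lambda_X\le\omega$ is its length. It is separated if for every $x\neq 0$ some $\|x\|_{X,n}\ne 0$, and graded if $\|x\|_{X,n}\le\|x\|_{X,m}$ for all $x$ and $n\le m<\lambda_X$. A Fréchet space is a separated multi-seminormed space (carrying its fixed sequence of seminorms) which is complete for the topology generated by the seminorms. $\mathcal M_{<\omega}$ is the class of finite-dimensional multi-seminormed spaces of finite length and $\mathcal G_{<\omega}$ the class of its graded members. For $\delta\ge 0$, $\mathrm{Emb}_\delta(X,Y)$ is the set of injective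 linear $f:X\to Y$ (with $\lambda_X\le\lambda_Y$) such that $\frac1{1+\delta}\|x\|_{X,m}\le\|f(x)\|_{Y,m}\le(1+\delta)\|x\|_{X,m}$ for all $x\in X$, $m<\lambda_X$; $\mathrm{Emb}=\mathrm{Emb}_0$ is the set of multi-isometric embeddings. A multi-isometry is a surjective multi-isometric embedding between spaces of the same length; $\mathrm{Iso}(E)$ is the group of multi-isometries $E\to E$. For linear $h:X\to Y$ and $n<\lambda_X\le\lambda_Y$, $\|h\|_n:=\sup\{\|h(x)\|_{Y,n}:\|x\|_{X,n}\le1\}$. For a class $\mathcal K$ of finite-dimensional multi-seminormed spaces: $E$ is $\mathcal K$-universal if every $X\in\mathcal K$ admits a multi-isometric embedding into $E$; $E$ is approximately $\mathcal K$-ultrahomogeneous if for every $\varepsilon>0$, $X\in\mathcal K$ and $\gamma,\eta\in\mathrm{Emb}(X,E)$ there is $g\in\mathrm{Iso}(E)$ with $\|g\circ\gamma-\eta\|_n\le\varepsilon$ for each $n<\lambda_X$; $E$ is $\mathcal K$-Fraïssé if there is a function $\varpi:\mathbb N\times(\mathbb N\cup\{\omega\})\times[0,\infty[\,\to[0,\infty[$, with each $\varpi(d,l,\cdot)$ increasing and continuous at $0$ with value $0$, such that for every $\varepsilon>0$, $\delta\ge0$, $X\in\mathcal K$ with $X\neq\{0\}$ and $\gamma,\eta\in\mathrm{Emb}_\delta(X,E)$ there is $g\in\mathrm{Iso}(E)$ with $\|g\circ\gamma-\eta\|_n\le\varpi(\dim X,\lambda_X,\delta)+\varepsilon$ for each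 $n<\lambda_X$. The two spaces: $\mathbb G$ is the Gurarij space. By a known theorem of Bargetz, Kąkol and Kubiś, there are sequences of seminorms $(\|\cdot\|_n)_{n<\omega}$ and $(\|\cdot\|'_n)_{n<\omega}$ on the countable power $\mathbb G^\omega$ such that $(\mathbb G^\omega,(\|\cdot\|_n)_{n<\omega})$ is a separable graded Fréchet space which is universal and Fraïssé (in particular approximately ultrahomogeneous) for the class of all finite-dimensional graded separated multi-seminormed spaces of length $\omega$, and $(\mathbb G^\omega,(\|\cdot\|'_n)_{n<\omega})$ is a separable Fréchet space which is universal and Fraïssé (in particular approximately ultrahomogeneous) for the class of all finite-dimensional separated multi-seminormed spaces of length $\omega$. These are the spaces in the claim. $\mathrm{Age}_{<\omega}(E)$ is the class of all $(X,(\|\cdot\|_{E,n})_{n<m})$ with $X$ a finite-dimensional subspace of $E$ and $1\le m\le\lambda_E$, $m<\omega$. For $\mathcal K\in\{\mathcal G_{<\omega},\mathcal M_{<\omega}\}$, $\mathrm{Flim}(\mathcal K)$ (the Fraïssé limit) is the separable $\mathcal K$-Fraïssé Fréchet space $E$, unique up to multi-isometry, such that $\mathrm{Age}_{<\omega}(E)$ and $\mathcal K$ coincide up to multi-isometry of their members. *)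

(* Defs.v *)
From HB Require Import structures.
From mathcomp Require Import all_boot all_order all_algebra.
From mathcomp Require Import all_classical all_reals all_analysis.

Set Implicit Arguments.
Unset Strict Implicit.
Unset Printing Implicit Defensive.

Import Order.TTheory GRing.Theory Num.Theory.
Import numFieldNormedType.Exports.

Local Open Scope classical_set_scope.
Local Open Scope ring_scope.

(* Finite lengths, and the length omega. *)
Inductive length := FinLen of nat | Omega.

Definition below (n : nat) (l : length) : bool :=
  if l is FinLen k then (n < k)%N else true.

Definition len_pos (l : length) : bool := below 0 l.

Definition len_le (l1 l2 : length) : bool :=
  match l1, l2 with
  | FinLen k1, FinLen k2 => (k1 <= k2)%N
  | _, Omega => true
  | Omega, FinLen _ => false
  end.

Lemma below_le (n : nat) (l1 l2 : length) :
  len_le l1 l2 -> below n l1 -> below n l2.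
Proof. by case: l1 l2 => [k1|] [k2|] //= h12 /leq_trans; apply. Qed.

(* Nonnegativity and p 0 = 0 follow from the two clauses. *)
Definition is_seminorm (R : realType) (V : lmodType R) (p : V -> R) : Prop :=
  (forall x y, p (x + y) <= p x + p y) /\
  (forall (a : R) x, p (a *: x) = `|a| * p x).

(* Only the values [mss_norm X n] with [below n (mss_len X)] are part of the
   structure; the others are irrelevant. *)
Record mss (R : realType) := MSS {
  mss_sort :> lmodType R;
  mss_len : length;
  mss_norm : nat -> mss_sort -> R;
  mss_len_pos : len_pos mss_len;
  mss_normP : forall n, below n mss_len -> is_seminorm (mss_norm n)
}.
Arguments mss_norm {R} m n x : rename.

Definition separated (R : realType) (X : mss R) : Prop :=
  forall x : X, x != 0 -> exists2 n, below n (mss_len X) & mss_norm X n x != 0.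

Definition graded (R : realType) (X : mss R) : Prop :=
  forall n m, (n <= m)%N -> below m (mss_len X) ->
    forall x : X, mss_norm X n x <= mss_norm X m x.

Definition has_dim (R : realType) (V : lmodType R) (d : nat) : Prop :=
  exists f : {linear V -> 'rV[R]_d}, bijective f.

Definition finite_dim (R : realType) (V : lmodType R) : Prop :=
  exists d, has_dim V d.

Section Topology.
Variables (R : realType) (X : mss R).

(* A copy of the carrier, bearing the uniformity generated by the seminorms. *)
Definition mss_space : Type := X.

HB.instance Definition _ := Choice.on mss_space.

(* The uniformity is generated by the relations p_n (x - y) < r; finitely many
   of them contain, for N and r suitable, the intersection over n < N. *)
Definition mss_basic (i : nat * R) : set (mss_space * mss_space) :=
  [set xy | forall n, (n < i.1)%N -> below n (mss_len X) ->
     mss_norm X n ((xy.1 : X) - (xy.2 : X)) < i.2].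

Definition mss_ent : set_system (mss_space * mss_space) :=
  filter_from [set i : nat * R | 0 < i.2] mss_basic.

Local Lemma mss_norm0 n : below n (mss_len X) -> mss_norm X n 0 = 0.
Proof.
by move=> /mss_normP[_ h]; have := h 0 0; rewrite scale0r normr0 mul0r.
Qed.

Local Lemma mss_normN n x :
  below n (mss_len X) -> mss_norm X n (- x) = mss_norm X n x.
Proof.
by move=> /mss_normP[_ h]; rewrite -scaleN1r h normrN normr1 mul1r.
Qed.

Fact mss_ent_filter : Filter mss_ent.
Proof.
apply: filter_from_filter; first by exists (0%N, 1) => /=.
move=> [N r] [M s] /= r0 s0; exists (maxn N M, Num.min r s) => /=.
  by rewrite lt_min r0.
move=> [x y] /= h; split=> n /= nN nl.
  by have := h n (leq_trans nN (leq_maxl _ _)) nl; rewrite lt_min => /andP[].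
by have := h n (leq_trans nN (leq_maxr _ _)) nl; rewrite lt_min => /andP[].
Qed.

Local Open Scope relation_scope.

Fact mss_ent_refl A : mss_ent A -> diagonal `<=` A.
Proof.
move=> [[N r] /= r0 h] [x y] /= xy; apply: h => n /= _ nl.
have {}xy : x = y by [].
by rewrite xy subrr mss_norm0.
Qed.

Fact mss_ent_inv A : mss_ent A -> mss_ent A^-1.
Proof.
move=> [[N r] /= r0 h]; exists (N, r) => // -[x y] /= xy; apply: h => n /= nN nl.
by rewrite -mss_normN // opprB; exact: xy.
Qed.

Fact mss_ent_split A :
  mss_ent A -> exists2 B, mss_ent B & B \; B `<=` A.
Proof.
move=> [[N r] /= r0 h]; exists (mss_basic (N, r / 2)).
  by exists (N, r / 2) => //=; rewrite divr_gt0.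
move=> [x y] [z /= xz zy]; apply: h => n /= nN nl.
rewrite -(subrKA (z : X)) (splitr r).
apply: le_lt_trans (ltrD (xz n nN nl) (zy n nN nl)).
exact: (proj1 (mss_normP nl)).
Qed.

HB.instance Definition _ := isUniform.Build mss_space
  mss_ent_filter mss_ent_refl mss_ent_inv mss_ent_split.

End Topology.

Definition complete_mss (R : realType) (X : mss R) : Prop :=
  forall F : set_system (mss_space X), ProperFilter F -> cauchy F ->
    exists x : mss_space X, F --> x.

Definition frechet (R : realType) (X : mss R) : Prop :=
  separated X /\ complete_mss X.

Definition separable (T : topologicalType) : Prop :=
  exists2 D : set T, countable D & dense D.

Definition is_Emb (R : realType) (delta : R) (X Y : mss R)
    (f : {linear X -> Y}) : Prop :=
  [/\ len_le (mss_len X) (mss_len Y),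
      injective f &
      forall x m, below m (mss_len X) ->
        (1 + delta)^-1 * mss_norm X m x <= mss_norm Y m (f x) /\
        mss_norm Y m (f x) <= (1 + delta) * mss_norm X m x].

Definition is_multi_isometry (R : realType) (X Y : mss R)
    (f : {linear X -> Y}) : Prop :=
  [/\ mss_len X = mss_len Y, is_Emb 0 f & set_surj setT setT f].

Definition is_Iso (R : realType) (E : mss R) (g : {linear E -> E}) : Prop :=
  is_multi_isometry g.

Definition multi_isometric (R : realType) (X Y : mss R) : Prop :=
  exists f : {linear X -> Y}, is_multi_isometry f.

(* Possibly infinite when [mss_norm X n] has a nonzero kernel. *)
Definition opnorm (R : realType) (X Y : mss R) (n : nat) (h : X -> Y) : \bar R :=
  ereal_sup [set (mss_norm Y n (h x))%:E | x in [set x | mss_norm X n x <= 1]].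

Definition universal (R : realType) (K : mss R -> Prop) (E : mss R) : Prop :=
  forall X, K X -> exists f : {linear X -> E}, is_Emb 0 f.

Definition approx_ultrahomogeneous (R : realType) (K : mss R -> Prop)
    (E : mss R) : Prop :=
  forall (eps : R) (X : mss R) (gamma eta : {linear X -> E}),
    0 < eps -> K X -> is_Emb 0 gamma -> is_Emb 0 eta ->
    exists g : {linear E -> E}, is_Iso g /\
      forall n, below n (mss_len X) ->
        (opnorm n (fun x : X => g (gamma x) - eta x)%R <= eps%:E)%E.

Definition is_modulus (R : realType) (w : nat -> length -> R -> R) : Prop :=
  forall d l, (0 < d)%N -> len_pos l ->
    [/\ forall t, 0 <= t -> 0 <= w d l t,
        forall s t, 0 <= s -> s <= t -> w d l s <= w d l t,
        w d l 0 = 0 &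
        w d l t @[t --> 0^'+] --> (0 : R)].

Definition fraisse (R : realType) (K : mss R -> Prop) (E : mss R) : Prop :=
  exists w : nat -> length -> R -> R, is_modulus w /\
    forall (eps delta : R) (X : mss R) (d : nat) (gamma eta : {linear X -> E}),
      0 < eps -> 0 <= delta -> K X -> has_dim X d -> (exists x : X, x != 0) ->
      is_Emb delta gamma -> is_Emb delta eta ->
      exists g : {linear E -> E}, is_Iso g /\
        forall n, below n (mss_len X) ->
          (opnorm n (fun x : X => g (gamma x) - eta x)%R
             <= (w d (mss_len X) delta + eps)%:E)%E.

Definition class_M_fin (R : realType) : mss R -> Prop :=
  fun X => finite_dim X /\ exists l, mss_len X = FinLen l.
Arguments class_M_fin : clear implicits.

Definition class_G_fin (R : realType) : mss R -> Prop :=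
  fun X => class_M_fin R X /\ graded X.
Arguments class_G_fin : clear implicits.

Definition class_sep_omega (R : realType) : mss R -> Prop :=
  fun X => [/\ finite_dim X, mss_len X = Omega & separated X].
Arguments class_sep_omega : clear implicits.

Definition class_graded_sep_omega (R : realType) : mss R -> Prop :=
  fun X => class_sep_omega R X /\ graded X.
Arguments class_graded_sep_omega : clear implicits.

Section Age.
Variables (R : realType) (E : mss R) (P : pred E) (S : subLmodType P) (m : nat).
Hypotheses (m_gt0 : (0 < m)%N) (m_le : len_le (FinLen m) (mss_len E)).

Fact sub_mss_normP n : below n (FinLen m) ->
  is_seminorm (fun x : S => mss_norm E n (\val x)).
Proof.
move=> /(below_le m_le)/mss_normP[pD pZ].
by split=> [x y|a x]; rewrite ?raddfD ?linearZ; [exact: pD | exact: pZ].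
Qed.

Definition sub_mss : mss R :=
  @MSS R S (FinLen m) (fun n x => mss_norm E n (\val x)) m_gt0 sub_mss_normP.

End Age.

(* [subLmodType P] ranges over the linear subspaces [P] of [E]. *)
Definition Age_fin (R : realType) (E : mss R) : mss R -> Prop :=
  fun X => exists (P : pred E) (S : subLmodType P) (m : nat)
             (m_gt0 : (0 < m)%N) (m_le : len_le (FinLen m) (mss_len E)),
             finite_dim S /\ X = sub_mss S m_gt0 m_le.

Definition coincide (R : realType) (K L : mss R -> Prop) : Prop :=
  (forall X, K X -> exists2 Y, L Y & multi_isometric X Y) /\
  (forall Y, L Y -> exists2 X, K X & multi_isometric X Y).

(* [is_Flim K E]: the space E is the Fraisse limit of K, which is determined up
   to multi-isometry. *)
Definition is_Flim (R : realType) (K : mss R -> Prop) (E : mss R) : Prop :=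
  [/\ separable (mss_space E), frechet E, fraisse K E & coincide (Age_fin E) K].

(* The extension property of Gurarij for pairs of finite-dimensional Banach
   spaces, A being isometrically included in B by i. *)
Definition gurarij (R : realType) (G : completeNormedModType R) : Prop :=
  separable G /\
  forall (eps : R) (A B : normedModType R) (i : {linear A -> B})
      (f : {linear A -> G}),
    0 < eps -> finite_dim A -> finite_dim B ->
    (forall x, `|i x| = `|x|) -> (forall x, `|f x| = `|x|) ->
    exists h : {linear B -> G},
      (forall x, h (i x) = f x) /\
      (forall y, (1 + eps)^-1 * `|y| <= `|h y| /\ `|h y| <= (1 + eps) * `|y|).

(* The countable power of G with a sequence of seminorms. *)
Definition power_mss (R : realType) (G : completeNormedModType R)
    (p : nat -> (nat -> G) -> R) (hp : forall n, is_seminorm (p n)) : mss R :=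
  @MSS R (nat -> G) Omega p isT (fun n _ => hp n).

(* Main.v *)
From HB Require Import structures.
From mathcomp Require Import all_boot all_order all_algebra.
From mathcomp Require Import all_classical all_reals all_analysis.
From mathcomp Require Import lra.
Require Import Defs.

Local Open Scope ring_scope.

(** The embeddings to be matched control only the first m seminorms of E,
whereas the known homogeneity of E concerns spaces carrying all of them. The
gap is bridged by amalgamation.

Let X have finite length m and let gamma, eta : X -> E be embeddings with
distortion at most 1 + t. Pulling back all the seminorms of E along gamma and
along eta gives two sequences a and b of seminorms on X, each of which makes X
a separated space of length omega ([pullback]). For n < m both a n and b n are
within a factor 1 + t of the seminorm p n of X; for n >= m they are unrelated.
On X * X put, with c slightly above (1 + t) - (1 + t)^-1,
- for n < m, the infimum over z of a n (x + z) + b n (y - z) + c * p n z;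
- for n >= m, the sum a n x + b n y.
Both inclusions of X in this [amalgam] are isometric for a and b respectively
([amalgam_inl], [amalgam_inr]), while (x, 0) and (0, x) are at distance at most
c * p n x for all n < m ([amalgam_antidiag]). The amalgam is separated because
c > 0 ([amalgam_ker]), and it is graded when X and E are ([amalgam_graded]).
By universality it embeds in E by some phi. The homogeneity of E, used twice
and for isometric embeddings only, yields isometries g1 and g2 of E with g1
gamma x close to phi (x, 0) and g2 eta x close to phi (0, x) for every seminorm
([exists_Iso_close]). Then g2^-1 g1 gamma is as close to eta as c allows, which
proves the Fraisse property with modulus t |-> (1 + t) - (1 + t)^-1
([fraisse_fin_class]). The case t = 0 is approximate ultrahomogeneity.

For the age, a space of finite length becomes a separated space of length
omega when its last seminorm plus a norm is repeated for ever
([omega_extension]); universality embeds the result in E, and the range of the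
embedding with its first m seminorms is a copy of the given space
([coincide_Age_fin]). *)

(** * Seminorms and linear maps *)

Section Proofs.
Set Implicit Arguments.
Unset Strict Implicit.
Import Order.TTheory GRing.Theory Num.Theory.
Import numFieldNormedType.Exports.
Local Open Scope classical_set_scope.
Variable R : realType.

Lemma len_le_refl l : len_le l l.
Proof. by case: l => [k|] //=; exact: leqnn. Qed.

Lemma seminorm0 (V : lmodType R) (q : V -> R) : is_seminorm q -> q 0 = 0.
Proof. by case=> _ h; have := h 0 0; rewrite scale0r normr0 mul0r. Qed.

Lemma seminormN (V : lmodType R) (q : V -> R) x : is_seminorm q -> q (- x) = q x.
Proof. by case=> _ h; rewrite -scaleN1r h normrN normr1 mul1r. Qed.

Lemma seminorm_ge0 (V : lmodType R) (q : V -> R) x : is_seminorm q -> 0 <= q x.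
Proof.
move=> hq; have := hq.1 x (- x); rewrite subrr seminorm0// seminormN//; lra.
Qed.

Lemma seminorm_comp (V W : lmodType R) (f : {linear V -> W}) (q : W -> R) :
  is_seminorm q -> is_seminorm (q \o f).
Proof.
by move=> [qD qZ]; split=> [x y|a x] /=; rewrite ?linearD ?linearZ; [exact: qD|exact: qZ].
Qed.

Lemma seminormD (V : lmodType R) (q r : V -> R) :
  is_seminorm q -> is_seminorm r -> is_seminorm (fun x => q x + r x).
Proof.
move=> [qD qZ] [rD rZ]; split=> [x y|a x]; last by rewrite qZ rZ mulrDr.
by rewrite addrACA lerD.
Qed.

Lemma seminormM (V : lmodType R) (q : V -> R) c :
  0 <= c -> is_seminorm q -> is_seminorm (fun x => c * q x).
Proof.
move=> c0 [qD qZ]; split=> [x y|a x]; last by rewrite qZ mulrCA.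
by rewrite -mulrDr ler_wpM2l.
Qed.

Definition linear_of (U V : lmodType R) (f : U -> V) (hf : linear f) : {linear U -> V} :=
  HB.pack f (GRing.isLinear.Build R U V _ f hf).

Lemma linear_diffZ (V W : lmodType R) (f g : {linear V -> W}) a x :
  f (a *: x) - g (a *: x) = a *: (f x - g x).
Proof. by rewrite scalerBr; congr (_ - _); exact: linearZ. Qed.

(** For a seminorm q on W * V this is the quotient seminorm on W, under the
first projection. *)
Definition inf_norm (W V : lmodType R) (q : W * V -> R) (w : W) : R :=
  inf [set q (w, z) | z in setT].

Section InfNorm.
Variables (W V : lmodType R) (q : W * V -> R).
Hypothesis hq : is_seminorm q.

Lemma inf_norm_le w z : inf_norm q w <= q (w, z).
Proof.
apply: ge_inf; last by exists z.
by exists 0 => _ [y _ <-]; exact: seminorm_ge0.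
Qed.

Lemma le_inf_norm c w : (forall z, c <= q (w, z)) -> c <= inf_norm q w.
Proof.
move=> h; apply: lb_le_inf; first by exists (q (w, 0)); exists 0.
by move=> _ [z _ <-].
Qed.

Lemma inf_norm_seminorm : is_seminorm (inf_norm q).
Proof.
have ge0 w : 0 <= inf_norm q w by apply: le_inf_norm => z; exact: seminorm_ge0.
split=> [x y|a x].
  rewrite -lerBlDl; apply: le_inf_norm => z; rewrite lerBlDl -lerBlDr.
  apply: le_inf_norm => t; rewrite lerBlDr.
  exact: le_trans (inf_norm_le _ (t + z)) (hq.1 (x, t) (y, z)).
have sub b v : inf_norm q (b *: v) <= `|b| * inf_norm q v.
  have [->|b0] := eqVneq b 0.
    by rewrite normr0 mul0r scale0r -[leRHS](seminorm0 hq) inf_norm_le.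
  rewrite -ler_pdivrMl ?normr_gt0//; apply: le_inf_norm => z.
  rewrite ler_pdivrMl ?normr_gt0// -hq.2; exact: inf_norm_le.
apply/le_anti; rewrite sub/=.
have [->|a0] := eqVneq a 0; first by rewrite normr0 mul0r.
rewrite -ler_pdivlMl ?normr_gt0// -normfV.
by have := sub a^-1 (a *: x); rewrite scalerA mulVf// scale1r.
Qed.

End InfNorm.

(** The pointwise bound contains more than its restriction to the unit ball
suggests: where the seminorm of X vanishes, so does that of h x, since all the
multiples of x lie in the unit ball. Hence the proof rescales by an arbitrary
r > |x|, rather than by |x|, and lets r tend to |x|. *)
Lemma opnorm_leP (X Y : mss R) n (h : X -> Y) (c : R) :
    below n (mss_len X) -> below n (mss_len Y) -> 0 <= c ->
    (forall a x, h (a *: x) = a *: h x) ->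
  (opnorm n h <= c%:E)%E <-> forall x, mss_norm Y n (h x) <= c * mss_norm X n x.
Proof.
move=> /mss_normP hX /mss_normP hY c0 hZ; split=> [hc x|hc]; last first.
  apply: ge_ereal_sup => _ [x /= x1 <-]; rewrite lee_fin.
  by rewrite (le_trans (hc x))// ler_piMr.
have key r : mss_norm X n x < r -> mss_norm Y n (h x) <= c * r.
  move=> xr; have r0 : 0 < r by rewrite (le_lt_trans _ xr)// seminorm_ge0.
  rewrite -ler_pdivrMr// mulrC -[r^-1]gtr0_norm ?invr_gt0// -hY.2 -hZ -lee_fin.
  apply: le_trans hc; apply: ereal_sup_ubound; exists (r^-1 *: x) => //=.
  by rewrite hX.2 gtr0_norm ?invr_gt0// ler_pdivrMl// mulr1 ltW.
apply/ler_addgt0Pr => e e0.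
have c1 : 0 < c + 1 by rewrite ltr_wpDl.
have /key/le_trans : mss_norm X n x < mss_norm X n x + e / (c + 1).
  by rewrite ltrDl divr_gt0.
apply; rewrite mulrDr lerD2l mulrCA ler_piMr ?(ltW e0)// ler_pdivrMr//; lra.
Qed.

(** * Pullbacks and isometric embeddings *)

Section Pullback.
Variables (V : lmodType R) (E : mss R) (f : {linear V -> E}).

Definition pullback : mss R :=
  @MSS R V (mss_len E) (fun n => mss_norm E n \o f) (mss_len_pos E)
    (fun n nE => seminorm_comp f (mss_normP nE)).

Lemma pullback_separated : injective f -> separated E -> separated pullback.
Proof. by move=> fI sE x x0; apply: sE; rewrite -(linear0 f) (inj_eq fI). Qed.

Lemma pullback_graded : graded E -> graded pullback.
Proof. by move=> gE n k nk kE x; exact: gE. Qed.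

End Pullback.

Lemma Emb0_norm (X Y : mss R) (f : {linear X -> Y}) n x :
  is_Emb 0 f -> below n (mss_len X) -> mss_norm Y n (f x) = mss_norm X n x.
Proof.
move=> [_ _ h] /(h x); rewrite addr0 invr1 !mul1r => -[h1 h2].
by apply/le_anti; rewrite h1 h2.
Qed.

Lemma Emb0P (X Y : mss R) (f : {linear X -> Y}) :
    len_le (mss_len X) (mss_len Y) -> injective f ->
    (forall n x, below n (mss_len X) -> mss_norm Y n (f x) = mss_norm X n x) ->
  is_Emb 0 f.
Proof.
by move=> lXY fI fE; split=> // x n nX; rewrite fE// addr0 invr1 !mul1r.
Qed.

Lemma has_dim_gt0 (V : lmodType R) d :
  has_dim V d -> (exists x : V, x != 0) -> (0 < d)%N.
Proof.
case: d => // -[f /bij_inj fI] [y /eqP[]].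
by apply: fI; rewrite !thinmx0.
Qed.

Lemma has_dim_prod (V : lmodType R) d : has_dim V d -> has_dim (V * V)%type (d + d).
Proof.
move=> [f [g fK gK]].
have lin : linear (fun w : V * V => row_mx (f w.1) (f w.2)).
  by move=> a u v; rewrite /= !linearP/= scale_row_mx add_row_mx.
exists (linear_of lin); exists (fun v => (g (lsubmx v), g (rsubmx v))) => [[x y]|v] /=.
  by rewrite row_mxKl row_mxKr !fK.
by rewrite !gK hsubmxK.
Qed.

(** * Amalgamation of two structures on one space *)

Section Amalgam.
Variables (V : lmodType R) (m : nat) (a b p : nat -> V -> R) (c : R).
Hypotheses (ha : forall n, is_seminorm (a n)) (hb : forall n, is_seminorm (b n)).
Hypothesis hp : forall n, (n < m)%N -> is_seminorm (p n).
Hypothesis c_gt0 : 0 < c.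

(** Passing to the infimum over the last variable glues the two copies of V
along the identity, at cost c * p: part of x may be moved to the second copy. *)
Definition glue n (t : V * V * V) : R :=
  a n (t.1.1 + t.2) + b n (t.1.2 - t.2) + c * p n t.2.

(** From m on, a and b are not assumed to be comparable, and nothing is glued. *)
Definition amalgam_norm n : V * V -> R :=
  if (n < m)%N then inf_norm (glue n) else fun w => a n w.1 + b n w.2.

Lemma glue_seminorm n : (n < m)%N -> is_seminorm (glue n).
Proof.
move=> /hp pn; apply: seminormD; last first.
  exact: (seminormM (ltW c_gt0) (seminorm_comp snd pn)).
have l1 : linear (fun t : V * V * V => t.1.1 + t.2).
  by move=> k u v /=; rewrite scalerDr addrACA.
have l2 : linear (fun t : V * V * V => t.1.2 - t.2).
  by move=> k u v /=; rewrite scalerBr opprD addrACA.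
exact: (seminormD (seminorm_comp (linear_of l1) (ha n))
                  (seminorm_comp (linear_of l2) (hb n))).
Qed.

Lemma amalgam_seminorm n : below n Omega -> is_seminorm (amalgam_norm n).
Proof.
move=> _; rewrite /amalgam_norm; case: ifP => [/glue_seminorm|_].
  exact: inf_norm_seminorm.
exact: (seminormD (seminorm_comp fst (ha n)) (seminorm_comp snd (hb n))).
Qed.

Definition amalgam : mss R :=
  @MSS R (V * V)%type Omega amalgam_norm isT amalgam_seminorm.

Lemma amalgam_norm_le n x y : amalgam_norm n (x, y) <= a n x + b n y.
Proof.
rewrite /amalgam_norm; case: ifP => [nm|//].
apply: le_trans (inf_norm_le (glue_seminorm nm) _ 0) _.
by rewrite /glue/= addr0 subr0 (seminorm0 (hp nm)) mulr0 addr0.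
Qed.

(** Moving z from the first copy to the second, where b measures it, saves at
most a n z; the hypothesis says that this costs at least as much. *)
Lemma amalgam_inl n x : ((n < m)%N -> forall z, a n z <= b n z + c * p n z) ->
  amalgam_norm n (x, 0) = a n x.
Proof.
move=> ab; apply/le_anti/andP; split.
  by have := amalgam_norm_le n x 0; rewrite (seminorm0 (hb n)) addr0.
rewrite /amalgam_norm; case: ifP => [nm|_] /=; last by rewrite (seminorm0 (hb n)) addr0.
apply: le_inf_norm => z; rewrite /glue/= sub0r seminormN//.
have := (ha n).1 (x + z) (- z); rewrite addrK seminormN//.
have := ab nm z; lra.
Qed.

Lemma amalgam_inr n y : ((n < m)%N -> forall z, b n z <= a n z + c * p n z) ->
  amalgam_norm n (0, y) = b n y.
Proof.
move=> ba; apply/le_anti/andP; split.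
  by have := amalgam_norm_le n 0 y; rewrite (seminorm0 (ha n)) add0r.
rewrite /amalgam_norm; case: ifP => [nm|_] /=; last by rewrite (seminorm0 (ha n)) add0r.
apply: le_inf_norm => z; rewrite /glue/= add0r.
have := (hb n).1 (y - z) z; rewrite subrK.
have := ba nm z; lra.
Qed.

(** The choice z = - x in the infimum cancels x in both copies. *)
Lemma amalgam_antidiag n x : (n < m)%N -> amalgam_norm n (x, - x) <= c * p n x.
Proof.
move=> nm; rewrite /amalgam_norm nm.
apply: le_trans (inf_norm_le (glue_seminorm nm) _ (- x)) _.
by rewrite /glue/= !subrr (seminorm0 (ha n)) (seminorm0 (hb n)) !add0r (seminormN _ (hp nm)).
Qed.

(** The reason for the strict inequality 0 < c: with c = 0, vectors
whose seminorms vanish from m on could be glued completely, and the amalgam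
would not be separated. *)
Lemma amalgam_ker D n x y : 0 <= D ->
    ((n < m)%N -> forall z, a n z <= D * p n z /\ b n z <= D * p n z) ->
  amalgam_norm n (x, y) = 0 -> a n x = 0 /\ b n y = 0.
Proof.
have a0 z := seminorm_ge0 z (ha n); have b0 z := seminorm_ge0 z (hb n).
move=> D0 hD; suff: exists K, a n x + b n y <= K * amalgam_norm n (x, y).
  move=> [K hK] w0; move: hK; rewrite w0 mulr0 => h.
  have := a0 x; have := b0 y; lra.
rewrite /amalgam_norm; case: ifP => [nm|_]; last by exists 1; rewrite mul1r.
have C0 : 0 <= D / c by rewrite divr_ge0// ltW.
have K0 : 0 < 1 + 2 * (D / c) by rewrite ltr_wpDr// mulr_ge0.
(* As a x <= a (x + z) + D p z, and likewise for b, only 2 D p z has to be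
   absorbed, by the summand c p z of [glue]. *)
exists (1 + 2 * (D / c)).
rewrite -ler_pdivrMl//; apply: le_inf_norm => z; rewrite ler_pdivrMl// /glue/=.
have [az bz] := hD nm z.
have := (ha n).1 (x + z) (- z); rewrite addrK seminormN// => ax.
have := (hb n).1 (y - z) z; rewrite subrK => bx.
set S := a n (x + z) + b n (y - z).
have S0 : 0 <= (D / c) * S by rewrite mulr_ge0// addr_ge0.
have -> : (1 + 2 * (D / c)) * (S + c * p n z) =
   S + c * p n z + 2 * ((D / c) * S) + 2 * (D * p n z).
  have -> : D * p n z = (D / c) * (c * p n z) by rewrite mulrA divfK// gt_eqF.
  lra.
have : 0 <= c * p n z by rewrite mulr_ge0 ?(ltW c_gt0)// (seminorm_ge0 _ (hp nm)).
rewrite /S in S0 *; lra.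
Qed.

(** At the passage from n < m to k >= m the quotient seminorm is compared with
the sum by means of z = 0. *)
Lemma amalgam_graded :
    (forall n k x, (n <= k)%N -> a n x <= a k x) ->
    (forall n k x, (n <= k)%N -> b n x <= b k x) ->
    (forall n k x, (n <= k < m)%N -> p n x <= p k x) ->
  graded amalgam.
Proof.
move=> ga gb gp n k nk _ [x y]; rewrite /= {2}/amalgam_norm.
case: ifP => [km|_]; last first.
  by rewrite (le_trans (amalgam_norm_le n x y))// lerD ?ga ?gb.
have nm := leq_ltn_trans nk km; rewrite /amalgam_norm nm.
apply: le_inf_norm => z; apply: le_trans (inf_norm_le (glue_seminorm nm) _ z) _.
by rewrite /glue/= !lerD ?ga ?gb// ler_pM2l// gp// nk.
Qed.

End Amalgam.

(** * The group of multi-isometries *)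

Lemma Iso_inv (E : mss R) (g : {linear E -> E}) : is_Iso g ->
  exists h : {linear E -> E}, is_Iso h /\ forall x, g (h x) = x.
Proof.
move=> [_ gE gS].
have [h gK] : {h : E -> E & forall x, g (h x) = x}.
  by apply: (@choice _ _ (fun x y => g y = x)) => x; have [y _ gy] := gS x Logic.I; exists y.
have gI : injective g by case: gE.
have lh : linear h by move=> k u v; apply: gI; rewrite linearP !gK.
exists (linear_of lh); split=> //; split=> //; last first.
  by move=> x _; exists (g x) => //; apply: gI; rewrite gK.
apply: Emb0P => [||n x nE] /=; first exact: len_le_refl.
  exact: can_inj gK.
by rewrite -(Emb0_norm _ gE nE) gK.
Qed.

Lemma Iso_comp (E : mss R) (g h : {linear E -> E}) :
  is_Iso g -> is_Iso h -> is_Iso (g \o h : {linear E -> E}).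
Proof.
move=> [_ gE gS] [_ hE hS]; have [lE gI _] := gE; have [_ hI _] := hE.
split=> //; last first.
  by move=> x _; have [y _ <-] := gS x Logic.I; have [z _ <-] := hS y Logic.I; exists z.
apply: Emb0P => // [|n x nE]; first exact: inj_comp.
by rewrite /= !Emb0_norm.
Qed.

Lemma Iso_id (E : mss R) : is_Iso (idfun : {linear E -> E}).
Proof.
split=> //.
by apply: Emb0P => //=; exact: len_le_refl.
Qed.

(** * Homogeneity for spaces of finite length *)

(** The flag gr switches the grading condition on or off, so that the graded
and the general case are treated at once. *)
Definition sep_omega_class (gr : Prop) (X : mss R) : Prop :=
  class_sep_omega R X /\ (gr -> graded X).

Definition fin_class (gr : Prop) (X : mss R) : Prop :=
  class_M_fin R X /\ (gr -> graded X).

(** This c solves (1 + t)^-1 + c = 1 + t: it is the least cost for which two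
seminorms within a factor 1 + t of a third one can be glued along it. *)
Definition distortion (t : R) : R := (1 + t) - (1 + t)^-1.

Lemma distortion_modulus : is_modulus (fun _ _ => distortion).
Proof.
move=> d l _ _; rewrite /distortion.
have d0 : (1 + 0) - (1 + 0)^-1 = 0 :> R by rewrite addr0 invr1 subrr.
have mono (s t : R) : 0 <= s -> s <= t ->
    (1 + s) - (1 + s)^-1 <= (1 + t) - (1 + t)^-1.
  by move=> s0 st; rewrite lerB ?lerD2l// lef_pV2 ?posrE; lra.
split=> //; first by move=> t t0; rewrite -d0 mono.
apply: cvg_at_right_filter; rewrite -[X in _ --> X]d0.
apply: cvgB; first by apply: cvgD; [exact: cvg_cst|exact: cvg_id].
apply: cvgV; first by rewrite addr0 oner_neq0.
by apply: cvgD; [exact: cvg_cst|exact: cvg_id].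
Qed.

Section FraisseFin.
Variables (gr : Prop) (E : mss R).
Hypotheses (lenE : mss_len E = Omega) (sepE : separated E) (grE : gr -> graded E).
Hypothesis univE : universal (sep_omega_class gr) E.
Hypothesis fraE : fraisse (sep_omega_class gr) E.

Let belowE n : below n (mss_len E). Proof. by rewrite lenE. Qed.

(** The homogeneity of E for isometric embeddings of the pullback structure. The
operator norms are those of that structure, so the error in each seminorm of E
is relative to the same seminorm along gamma. *)
Lemma exists_Iso_close (X : mss R) (gamma : {linear X -> E}) (phi : {linear X -> E}) (e : R) :
    finite_dim X -> (exists x : X, x != 0) -> injective gamma ->
    (forall n x, mss_norm E n (phi x) = mss_norm E n (gamma x)) -> 0 < e ->
  exists2 g : {linear E -> E}, is_Iso g &
    forall n x, mss_norm E n (g (gamma x) - phi x) <= e * mss_norm E n (gamma x).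
Proof.
move=> [d hd] nz gI phiE e0.
have phiI : injective phi.
  move=> x y xy; apply: gI; apply/eqP; rewrite -subr_eq0 -linearB.
  apply/negPn/negP => /sepE[n _]; rewrite -phiE linearB xy subrr.
  by rewrite seminorm0 ?eqxx//; exact: mss_normP.
have [w [hw hfra]] := fraE.
have Kp : sep_omega_class gr (pullback gamma).
  split=> [|/grE]; last exact: pullback_graded.
  by split; [exists d|exact: lenE|exact: pullback_separated].
have [g [gIso hg]] := hfra e 0 (pullback gamma) d gamma phi e0 (lexx _) Kp hd nz
  (Emb0P (X := pullback gamma) (f := gamma) (len_le_refl _) gI (fun _ _ _ => erefl))
  (Emb0P (X := pullback gamma) (f := phi) (len_le_refl _) phiI (fun n x _ => phiE n x)).
exists g => // n x; have := hg n (belowE n).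
have [_ _ -> _] := hw d (mss_len (pullback gamma)) (has_dim_gt0 hd nz) (mss_len_pos _).
have hZ k (y : X) : g (gamma (k *: y)) - phi (k *: y) = k *: (g (gamma y) - phi y).
  exact: (linear_diffZ (g \o gamma)).
by rewrite add0r => /opnorm_leP; apply; rewrite ?(ltW e0).
Qed.

Lemma fraisse_fin_class : fraisse (fin_class gr) E.
Proof.
exists (fun _ _ => distortion); split; first exact: distortion_modulus.
move=> e t X d gamma eta e0 t0 [[_ [m lenX]] grX] hd nz [_ gI hg] [_ hI hh].
have t1 : 0 < 1 + t by rewrite ltr_wpDr.
have dist0 : 0 <= distortion t.
  by have [h _ _ _] := distortion_modulus (d:=1%N) (l:=Omega) isT isT; exact: h.
(* One third of e makes c positive; the other two pay for g1 and g2. *)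
pose c := distortion t + e / 3.
have c0 : 0 < c by rewrite ltr_wpDl// divr_gt0.
have hX n : (n < m)%N -> below n (mss_len X) by rewrite lenX.
have hpX n : (n < m)%N -> is_seminorm (mss_norm X n) by move=> /hX/mss_normP.
have hE n : is_seminorm (mss_norm E n) by exact: mss_normP.
pose a n := mss_norm E n \o gamma; pose b n := mss_norm E n \o eta.
have ha n : is_seminorm (a n) by exact: seminorm_comp.
have hb n : is_seminorm (b n) by exact: seminorm_comp.
(* This is the hypothesis of amalgam_inl and amalgam_inr, for either order. *)
have close (f h : {linear X -> E}) n z : (n < m)%N ->
    mss_norm E n (f z) <= (1 + t) * mss_norm X n z ->
    (1 + t)^-1 * mss_norm X n z <= mss_norm E n (h z) ->
    mss_norm E n (f z) <= mss_norm E n (h z) + c * mss_norm X n z.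
  move=> nm fz hz; have p0 := seminorm_ge0 z (hpX n nm).
  have : 0 <= e / 3 * mss_norm X n z by rewrite mulr_ge0// divr_ge0// ltW.
  rewrite /c /distortion; lra.
pose Z := amalgam (V:=X) (m:=m) (a:=a) (b:=b) (p:=mss_norm X) (c:=c) ha hb hpX c0.
have ZK : sep_omega_class gr Z.
  split; first split=> //; first by exists (d + d)%N; exact: has_dim_prod.
    move=> [x y] xy0; apply: contrapT => noZ.
    have Z0 n : amalgam_norm m a b (mss_norm X) c n (x, y) = 0.
      by apply/eqP/negPn/negP => h; apply: noZ; exists n.
    have ker n : a n x = 0 /\ b n y = 0.
      apply: amalgam_ker (ltW t1) _ (Z0 n) => // nm z; split; first exact: (hg z n (hX n nm)).2.
      exact: (hh z n (hX n nm)).2.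
    move: xy0; rewrite -pair_eqE/= negb_and => /orP[x0|y0].
      have /sepE[n _ /eqP[]] : gamma x != 0 by rewrite -(linear0 gamma) (inj_eq gI).
      exact: (ker n).1.
    have /sepE[n _ /eqP[]] : eta y != 0 by rewrite -(linear0 eta) (inj_eq hI).
    exact: (ker n).2.
  move=> hgr; apply: amalgam_graded => n k x; last first.
    by case/andP=> nk km; apply: grX => //; rewrite lenX.
    by move=> nk; exact: (grE hgr).
  by move=> nk; exact: (grE hgr).
have [phi phiE] := univE ZK.
have li : linear (fun x : X => phi (x, 0)).
  by move=> k u v; rewrite -linearP; congr (phi (_, _)); rewrite /= scaler0 addr0.
have lj : linear (fun x : X => phi (0, x)).
  by move=> k u v; rewrite -linearP; congr (phi (_, _)); rewrite /= scaler0 addr0.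
(* The errors of g1 and g2 are relative to a and b, which may exceed the seminorms
   of X by the factor 1 + t. *)
pose e' := e / 3 / (1 + t).
have e'0 : 0 < e' by rewrite !divr_gt0.
have fdX : finite_dim X by exists d.
have [g1 g1I hg1] : exists2 g : {linear E -> E}, is_Iso g &
    forall n x, mss_norm E n (g (gamma x) - phi (x, 0)) <= e' * a n x.
  apply: (@exists_Iso_close X gamma (linear_of li)) => // n x /=.
  rewrite (Emb0_norm _ phiE)//; apply: amalgam_inl => // nm z.
  by apply: close => //; [exact: (hg z n (hX n nm)).2|exact: (hh z n (hX n nm)).1].
have [g2 g2I hg2] : exists2 g : {linear E -> E}, is_Iso g &
    forall n x, mss_norm E n (g (eta x) - phi (0, x)) <= e' * b n x.
  apply: (@exists_Iso_close X eta (linear_of lj)) => // n x /=.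
  rewrite (Emb0_norm _ phiE)//; apply: amalgam_inr => // nm z.
  by apply: close => //; [exact: (hh z n (hX n nm)).2|exact: (hg z n (hX n nm)).1].
have [h2 [h2I h2K]] := Iso_inv g2I.
exists (h2 \o g1 : {linear E -> E}); split; first exact: Iso_comp.
move=> n nX; have nm : (n < m)%N by rewrite lenX in nX.
apply/opnorm_leP => //; first by rewrite addr_ge0// ltW.
  by move=> k y; exact: (linear_diffZ (h2 \o g1 \o gamma)).
move=> x /=.
(* The isometry g2 carries the difference of h2 (g1 (gamma x)) and eta x to that
   of g1 (gamma x) and g2 (eta x), with phi (x, 0) and phi (0, x) in between. *)
have [_ g2E _] := g2I; rewrite -(Emb0_norm _ g2E)// linearB h2K.
have tri u v w s : mss_norm E n (u - s) <=
    mss_norm E n (u - v) + mss_norm E n (v - w) + mss_norm E n (s - w).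
  rewrite -(seminormN (s - w))// opprB.
  have -> : u - s = (u - v) + (v - w) + (w - s) by rewrite !addrA !subrK.
  by apply: le_trans ((hE n).1 _ _) _; rewrite lerD2r; exact: (hE n).1.
apply: le_trans (tri _ (phi (x, 0)) (phi (0, x)) _) _.
have diag : mss_norm E n (phi (x, 0) - phi (0, x)) <= c * mss_norm X n x.
  rewrite -linearB (Emb0_norm _ phiE)//.
  have -> : (x, 0) - (0, x) = (x, - x) :> Z by congr (_, _); rewrite ?subr0 ?sub0r.
  exact: amalgam_antidiag.
have bound y : y <= (1 + t) * mss_norm X n x -> e' * y <= e / 3 * mss_norm X n x.
  by move=> hy; rewrite /e' -[_ / _ * _]mulrA ler_pM2l ?divr_gt0// ler_pdivrMl.
have := le_trans (hg1 n x) (bound _ (hg x n nX).2).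
have := le_trans (hg2 n x) (bound _ (hh x n nX).2).
rewrite /c in diag; lra.
Qed.

Lemma fraisse_fin_approx_ultrahomogeneous :
  approx_ultrahomogeneous (fin_class gr) E.
Proof.
move=> e X gamma eta e0 KX gE hE.
(* The zero space is not covered by the Fraisse property. *)
have [nz|/forallNP z] := pselect (exists x : X, x != 0); last first.
  exists idfun; split; first exact: Iso_id.
  move=> n nX; apply/opnorm_leP => //; first exact: ltW.
    by move=> k y; exact: (linear_diffZ (idfun \o gamma)).
  move=> x; have /negP/negPn/eqP -> := z x.
  by rewrite /= (linear0 gamma) (linear0 eta) subrr (seminorm0 (mss_normP (belowE n)))
             (seminorm0 (mss_normP nX)) mulr0.
have [w [hw hfra]] := fraisse_fin_class.
have [[[d hd] _] _] := KX.
have [g [gI hg]] := hfra e 0 X d gamma eta e0 (lexx _) KX hd nz gE hE.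
exists g; split=> // n nX; have := hg n nX.
by have [_ _ -> _] := hw d (mss_len X) (has_dim_gt0 hd nz) (mss_len_pos _); rewrite add0r.
Qed.

End FraisseFin.

(** * Ages *)

Section RangeSubspace.
Variables (V W : lmodType R) (f : {linear V -> W}).

Definition range_pred : pred W := fun y => `[< exists x, f x = y >].

Lemma range_submod_closed : submod_closed range_pred.
Proof.
split=> [|k _ _ /asboolP[x <-] /asboolP[y <-]]; apply/asboolP.
  by exists 0; rewrite linear0.
by exists (k *: x + y); rewrite linearP.
Qed.

HB.instance Definition _ := GRing.isSubmodClosed.Build R W range_pred range_submod_closed.

Definition range_space : Type := {y | range_pred y}.

HB.instance Definition _ := SubChoice.on range_space.
HB.instance Definition _ := [SubChoice_isSubLmodule of range_space by <:].

Lemma in_range x : range_pred (f x).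
Proof. by apply/asboolP; exists x. Qed.

End RangeSubspace.

Lemma has_dim_bij (V W : lmodType R) (h : {linear V -> W}) d :
  bijective h -> has_dim W d -> has_dim V d.
Proof. by move=> hb [f fb]; exists (f \o h); exact: bij_comp. Qed.

(** The multi-isometry goes from the range to X, that is, it is the inverse of f;
its linearity and injectivity are read off from those of f. *)
Lemma range_Age_fin (X E : mss R) (f : {linear X -> E}) m :
    mss_len X = FinLen m -> finite_dim X -> is_Emb 0 f ->
  exists2 A, Age_fin E A & multi_isometric A X.
Proof.
move=> lenX [d hd] fE; have [lXE fI _] := fE.
have m0 : (0 < m)%N by have := mss_len_pos X; rewrite lenX.
have lmE : len_le (FinLen m) (mss_len E) by rewrite -lenX.
pose S : subLmodType (range_pred f) := range_space f.
have [h fK] : {h : S -> X & forall s, f (h s) = \val s}.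
  by apply: (@choice _ _ (fun s x => f x = \val s)) => s; have /asboolP := valP s.
have hl : linear h by move=> k u v; apply: fI; rewrite linearP !fK linearP.
have hK x : h (Sub (f x) (in_range f x)) = x by apply: fI; rewrite fK SubK.
have hI : injective h by move=> s t st; apply: val_inj; rewrite -!fK st.
have hb : bijective (linear_of hl).
  by exists (fun x => Sub (f x) (in_range f x)) => // s; apply: hI; rewrite hK.
exists (sub_mss S m0 lmE).
  exists (range_pred f), S, m, m0, lmE; split=> //.
  by exists d; exact: has_dim_bij hb hd.
exists (linear_of hl); split=> //; last by move=> x _; exists (Sub (f x) (in_range f x)).
apply: Emb0P => //; first by rewrite lenX; exact: len_le_refl.
by move=> n s nm /=; rewrite -(Emb0_norm _ fE) ?lenX// fK.
Qed.

Definition l1_norm d (v : 'rV[R]_d) : R := \sum_i `|v 0 i|.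

Lemma l1_norm_seminorm d : is_seminorm (@l1_norm d).
Proof.
split=> [u v|k u]; rewrite /l1_norm.
  by rewrite -big_split/=; apply: ler_sum => i _; rewrite mxE ler_normD.
by rewrite mulr_sumr; apply: eq_bigr => i _; rewrite mxE normrM.
Qed.

Lemma l1_norm_eq0 d (v : 'rV[R]_d) : l1_norm v = 0 -> v = 0.
Proof.
move=> v0; apply/rowP => i; rewrite mxE; apply: normr0_eq0.
by move/psumr_eq0P : v0 => ->.
Qed.

Section OmegaExtension.
Variables (X : mss R) (m d : nat) (f : {linear X -> 'rV[R]_d}).
Hypothesis lenX : mss_len X = FinLen m.

(** Adding the last of the m seminorms to the norm keeps a graded sequence
graded. *)
Definition ext_norm n : X -> R :=
  if (n < m)%N then mss_norm X n
  else fun x => mss_norm X m.-1 x + l1_norm (f x).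

Let m_gt0 : (0 < m)%N. Proof. by have := mss_len_pos X; rewrite lenX. Qed.

Let hX n : (n < m)%N -> is_seminorm (mss_norm X n).
Proof. by move=> nm; apply: mss_normP; rewrite lenX. Qed.

Let pred_lt : (m.-1 < m)%N. Proof. by rewrite ltn_predL. Qed.

Lemma ext_seminorm n : below n Omega -> is_seminorm (ext_norm n).
Proof.
move=> _; rewrite /ext_norm; case: ifP => [/hX//|_].
exact: (seminormD (hX pred_lt) (seminorm_comp f (l1_norm_seminorm d))).
Qed.

Definition omega_extension : mss R := @MSS R X Omega ext_norm isT ext_seminorm.

Lemma omega_extension_separated : injective f -> separated omega_extension.
Proof.
move=> fI x x0; exists m => //=; rewrite /ext_norm ltnn; apply: contra_neq x0 => e0.
apply: fI; rewrite linear0; apply: l1_norm_eq0.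
have := seminorm_ge0 x (hX pred_lt); have := seminorm_ge0 (f x) (l1_norm_seminorm d).
lra.
Qed.

Lemma omega_extension_graded : graded X -> graded omega_extension.
Proof.
move=> gX n k nk _ x; rewrite /= /ext_norm.
have := seminorm_ge0 (f x) (l1_norm_seminorm d).
case: (ltnP k m) => km l0; first by rewrite (leq_ltn_trans nk km) gX// lenX.
case: ifP => [nm|_//]; rewrite ler_wpDr// gX ?lenX//.
by rewrite -ltnS prednK.
Qed.

End OmegaExtension.

Lemma coincide_Age_fin (gr : Prop) (E : mss R) :
    mss_len E = Omega -> (gr -> graded E) -> universal (sep_omega_class gr) E ->
  coincide (Age_fin E) (fin_class gr).
Proof.
move=> lenE grE univE; split=> [_ [P [S [m [m0 [lmE [fdS ->]]]]]]|X [[fdX [m lenX]] grX]].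
  exists (sub_mss S m0 lmE); last by exists idfun; exact: Iso_id.
  split=> [|/grE gE n k nk km x]; first by split=> //; exists m.
  by apply: gE => //; rewrite lenE.
have [d [f /bij_inj fI]] := fdX.
have KX : sep_omega_class gr (omega_extension f lenX).
  split=> [|/grX]; last exact: omega_extension_graded.
  by split=> //; exact: omega_extension_separated.
have [g gE] := univE _ KX; have [_ gI _] := gE.
apply: (range_Age_fin (f := g : {linear X -> E}) lenX) => //.
apply: Emb0P => //; first by rewrite lenX lenE.
move=> n x nX; rewrite (Emb0_norm _ gE)//= /ext_norm.
by rewrite lenX/= in nX; rewrite nX.
Qed.

Lemma fin_class_Flim (gr : Prop) (E : mss R) :
    mss_len E = Omega -> (gr -> graded E) ->
    separable (mss_space E) -> frechet E ->
    universal (sep_omega_class gr) E -> fraisse (sep_omega_class gr) E ->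
  approx_ultrahomogeneous (fin_class gr) E /\ is_Flim (fin_class gr) E.
Proof.
move=> lenE grE sE fE uE frE; have [sepE _] := fE.
split; first exact: fraisse_fin_approx_ultrahomogeneous.
split=> //; first exact: fraisse_fin_class.
exact: coincide_Age_fin.
Qed.

End Proofs.

Theorem corollary3p9 (R : realType) (G : completeNormedModType R)
  (p p' : nat -> (nat -> G) -> R)
  (hG : gurarij G)
  (hp : forall n, is_seminorm (p n)) (hp' : forall n, is_seminorm (p' n))
  (p_separable : separable (mss_space (power_mss hp)))
  (p_graded : graded (power_mss hp))
  (p_frechet : frechet (power_mss hp))
  (p_universal : universal (class_graded_sep_omega R) (power_mss hp))
  (p_fraisse : fraisse (class_graded_sep_omega R) (power_mss hp))
  (p'_separable : separable (mss_space (power_mss hp')))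
  (p'_frechet : frechet (power_mss hp'))
  (p'_universal : universal (class_sep_omega R) (power_mss hp'))
  (p'_fraisse : fraisse (class_sep_omega R) (power_mss hp')) :
  (approx_ultrahomogeneous (class_G_fin R) (power_mss hp) /\
   approx_ultrahomogeneous (class_M_fin R) (power_mss hp')) /\
  (is_Flim (class_G_fin R) (power_mss hp) /\
   is_Flim (class_M_fin R) (power_mss hp')).
Proof.
have Gfin : class_G_fin R = fin_class True.
  by apply/funext => X; apply/propext; split=> -[? h]; split=> //; exact: h.
have Mfin : class_M_fin R = fin_class False.
  by apply/funext => X; apply/propext; split=> [h|[]].
have Gom : class_graded_sep_omega R = sep_omega_class True.
  by apply/funext => X; apply/propext; split=> -[? h]; split=> //; exact: h.
have Mom : class_sep_omega R = sep_omega_class False.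
  by apply/funext => X; apply/propext; split=> [h|[]].
rewrite Gom in p_universal p_fraisse; rewrite Mom in p'_universal p'_fraisse.
rewrite Gfin Mfin.
have [uG FG] := fin_class_Flim (E := power_mss hp) erefl (fun _ : True => p_graded)
  p_separable p_frechet p_universal p_fraisse.
have [uM FM] := fin_class_Flim (E := power_mss hp') erefl (False_ind _)
  p'_separable p'_frechet p'_universal p'_fraisse.
by split; split.
Qed.
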